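(* Let $\theta\in(0,1)$. The Neumann-Dirichlet algorithm ND$_3$ converges if and only if $$\rho_{\mathrm{ND}_3}:=\max_{1\le i\le n}\Big|1-\theta\Big(1+\frac{\sigma_i+d_i\tanh(a_i)}{\sigma_i\tanh(a_i)+d_i}\cdot\frac{\gamma\sigma_i\tanh(b_i)+\beta_i}{\gamma\sigma_i+\beta_i\tanh(b_i)}\Big)\Big|<1.$$
   Context: Let $A\in\mathbb{R}^{n\times n}$ be symmetric with eigenvalues $d_1,\dots,d_n$, and let $\nu>0$, $\gamma\ge 0$, $T>0$, $0<\alpha<T$. Set $\Omega_1=(0,\alpha)$, $\Omega_2=(\alpha,T)$, $\sigma_i=\sqrt{d_i^2+\nu^{-1}}$, $\beta_i=1-\gamma d_i$, $a_i=\sigma_i\alpha$, $b_i=\sigma_i(T-\alpha)$. Algorithm ND$_3$ (error equations): for each $i$, given an initial guess $f_i^0\in\mathbb{R}$, for $k=1,2,\dots$: (1) solve $\dot z_{1,i}^k+d_iz_{1,i}^k-\nu^{-1}\mu_{1,i}^k=0$, $\dot\mu_{1,i}^k-z_{1,i}^k-d_i\mu_{1,i}^k=0$ in $\Omega_1$ with $z_{1,i}^k(0)=0$, $\dot\mu_{1,i}^k(\alpha)=f_i^{k-1}$; (2) solve $\dot z_{2,i}^k+d_iz_{2,i}^k-\nu^{-1}\mu_{2,i}^k=0$, $\dot\mu_{2,i}^k-z_{2,i}^k-d_i\mu_{2,i}^k=0$ in $\Omega_2$ with $\mu_{2,i}^k(\alpha)=\mu_{1,i}^k(\alpha)$, $\mu_{2,i}^k(T)+\gamma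 z_{2,i}^k(T)=0$; (3) set $f_i^k=(1-\theta)f_i^{k-1}+\theta\dot\mu_{2,i}^k(\alpha)$. Assume all subdomain problems are uniquely solvable for every datum, so that the algorithm is well defined. The algorithm converges if $f_i^k\to 0$ as $k\to\infty$ for every $i$ and every initial guess $(f_1^0,\dots,f_n^0)\in\mathbb{R}^n$. *)

(* Defs.v *)
From HB Require Import structures.
From mathcomp Require Import all_boot all_order all_algebra.
From mathcomp Require Import all_classical all_reals all_analysis.

Set Implicit Arguments.
Unset Strict Implicit.
Unset Printing Implicit Defensive.

Import Order.TTheory GRing.Theory Num.Theory.
Import numFieldNormedType.Exports.

Local Open Scope classical_set_scope.
Local Open Scope ring_scope.

Definition tanh {R : realType} (x : R) : R :=
  (expR x - expR (- x)) / (expR x + expR (- x)).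

Definition left_derivative {R : realType} (g : R -> R) (x l : R) : Prop :=
  h^-1 * (g (h + x) - g x) @[h --> 0^'-] --> l.

Definition right_derivative {R : realType} (g : R -> R) (x l : R) : Prop :=
  h^-1 * (g (h + x) - g x) @[h --> 0^'+] --> l.

(* Classical solution on the open interval, continuous up to both endpoints;
   the values of z and mu outside [a, b] are irrelevant. *)
Definition state_adjoint {R : realType} (nu d a b : R) (z mu : R -> R) : Prop :=
  [/\ derivable_oo_LRcontinuous z a b,
      derivable_oo_LRcontinuous mu a b &
      forall t, t \in `]a, b[ ->
        derive1 z t + d * z t - nu^-1 * mu t = 0 /\
        derive1 mu t - z t - d * mu t = 0].

Definition subproblem1 {R : realType} (nu alpha d f : R) (z mu : R -> R) : Prop :=
  [/\ state_adjoint nu d 0 alpha z mu,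
      z 0 = 0 &
      left_derivative mu alpha f].

Definition subproblem2 {R : realType} (nu gamma T alpha d m : R)
    (z mu : R -> R) : Prop :=
  [/\ state_adjoint nu d alpha T z mu,
      mu alpha = m &
      mu T + gamma * z T = 0].

(* Uniqueness can only be asked for on [a, b], since solutions are represented
   by functions on the whole line. *)
Definition uniquely_solvable {R : realType} (a b : R)
    (P : R -> (R -> R) -> (R -> R) -> Prop) : Prop :=
  forall g : R,
    (exists z mu : R -> R, P g z mu) /\
    (forall z mu z' mu' : R -> R, P g z mu -> P g z' mu' ->
      forall t, t \in `[a, b] -> z t = z' t /\ mu t = mu' t).

(* One iteration for the eigenvalue d, sending the interface datum f to f'. *)
Definition ND3_step {R : realType} (nu gamma T alpha theta d f f' : R) : Prop :=
  exists z1 mu1 z2 mu2 : R -> R, exists dmu2 : R,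
    [/\ subproblem1 nu alpha d f z1 mu1,
        subproblem2 nu gamma T alpha d (mu1 alpha) z2 mu2,
        right_derivative mu2 alpha dmu2 &
        f' = (1 - theta) * f + theta * dmu2].

(* The iteration is a relation; when the subproblems are uniquely solvable,
   each initial guess has exactly one orbit. *)
Definition ND3_orbit {R : realType} (n : nat) (nu gamma T alpha theta : R)
    (d : 'I_n -> R) (f0 : 'I_n -> R) (f : nat -> 'I_n -> R) : Prop :=
  forall i : 'I_n, f 0%N i = f0 i /\
    forall k : nat, ND3_step nu gamma T alpha theta (d i) (f k i) (f k.+1 i).

Definition ND3_converges {R : realType} (n : nat) (nu gamma T alpha theta : R)
    (d : 'I_n -> R) : Prop :=
  forall (f0 : 'I_n -> R) (f : nat -> 'I_n -> R),
    ND3_orbit nu gamma T alpha theta d f0 f ->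
    forall i : 'I_n, f k i @[k --> \oo] --> (0 : R).

Definition ND3_factor {R : realType} (nu gamma T alpha theta d : R) : R :=
  let sigma := Num.sqrt (d ^+ 2 + nu^-1) in
  let beta := 1 - gamma * d in
  let a := sigma * alpha in
  let b := sigma * (T - alpha) in
  `| 1 - theta * (1 + (sigma + d * tanh a) / (sigma * tanh a + d) *
       ((gamma * sigma * tanh b + beta) / (gamma * sigma + beta * tanh b))) |.

(* The factors are nonnegative, so the default value 0 leaves the maximum of a
   nonempty family unchanged. *)
Definition rho_ND3 {R : realType} (n : nat) (nu gamma T alpha theta : R)
    (d : 'I_n -> R) : R :=
  \big[Num.max/0]_(i < n) ND3_factor nu gamma T alpha theta (d i).

(* Main.v *)
(** On both subdomains mu'' = s^2 mu with s^2 = d^2 + 1/nu, and the homogeneous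
boundary condition leaves a one-parameter family c * (explicit exponentials).
Unique solvability is used twice: it makes the coefficient relating c to the
datum nonzero, and it forces every solution to be the explicit one, so that no
uniqueness theorem for ODEs is needed. One iteration is therefore f' = r f, and
the algorithm converges iff every r has absolute value < 1. *)
Require Import Defs.
From HB Require Import structures.
From mathcomp Require Import all_boot all_order all_algebra.
From mathcomp Require Import all_classical all_reals all_analysis.
From mathcomp Require Import ring lra.

Set Implicit Arguments.
Unset Strict Implicit.
Unset Printing Implicit Defensive.

Import Order.TTheory GRing.Theory Num.Theory.
Import numFieldNormedType.Exports.

Local Open Scope classical_set_scope.
Local Open Scope ring_scope.

Lemma is_derive_cvg (R : realType) (g : R -> R) (x l : R) :
  is_derive x 1 g l -> h^-1 * (g (h + x) - g x) @[h --> 0^'] --> l.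
Proof.
move=> [dg <-].
have -> : (fun h => h^-1 * (g (h + x) - g x)) =
    (fun h => h^-1 *: ((g \o shift x) (h *: 1) - g x)).
  by apply/funext => h /=; rewrite /GRing.scale /= mulr1.
exact: dg.
Qed.

Lemma is_derive_left_derivative (R : realType) (g : R -> R) (x l : R) :
  is_derive x 1 g l -> left_derivative g x l.
Proof. by move=> /is_derive_cvg/cvg_dnbhs_at_left. Qed.

Lemma is_derive_right_derivative (R : realType) (g : R -> R) (x l : R) :
  is_derive x 1 g l -> right_derivative g x l.
Proof. by move=> /is_derive_cvg/cvg_dnbhs_at_right. Qed.

(** For small [e > 0] the quotient at [a] only samples points of [[a, b]], so agreement there
    suffices. This matches unique solvability, which controls solutions on the closed interval
    only. *)
Lemma right_derivative_unique (R : realType) (g h : R -> R) (a b l m : R) :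
  a < b -> {in `[a, b], g =1 h} ->
  right_derivative g a l -> right_derivative h a m -> l = m.
Proof.
move=> ab gh gl hm; apply: (cvg_unique _ _ hm) => //.
apply: cvg_trans gl; apply: near_eq_cvg; near=> e.
have e0 : 0 < e by near: e; exact: nbhs_right_gt.
have eb : e < b - a by near: e; apply: nbhs_right_lt; rewrite subr_gt0.
by rewrite !gh// in_itv/=; lra.
Unshelve. all: by end_near. Qed.

Lemma derivable_oo_LRcontinuousT (R : realType) (g : R -> R) (a b : R) :
  (forall x, derivable g x 1) -> derivable_oo_LRcontinuous g a b.
Proof.
move=> dg.
have cg x : {for x, continuous g}.
  exact/differentiable_continuous/derivable1_diffP.
split=> [x _||]; first exact: dg.
- exact/cvg_at_right_filter/cg.
- exact/cvg_at_left_filter/cg.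
Qed.

Section modes.
Context {R : realType}.
Implicit Types (nu gamma T alpha theta d s a u v t c : R).

(** General solution of [mu'' = s^2 mu], anchored at the endpoint [a] that carries the homogeneous
    condition. *)
Definition mode s a u v t : R :=
  u * expR (s * (t - a)) + v * expR (- (s * (t - a))).

Lemma modexx s a u v : mode s a u v a = u + v.
Proof. by rewrite /mode subrr mulr0 oppr0 expR0 !mulr1. Qed.

Lemma is_derive_mode s a u v t :
  is_derive t 1 (mode s a u v) (mode s a (s * u) (- (s * v)) t).
Proof.
rewrite /mode; apply: is_derive_eq.
rewrite /GRing.scale/=; ring.
Qed.

(** The adjoint equation gives [z = mu' - d mu], hence the coefficients [s - d] and [-(s + d)]; the
    state equation then amounts to [s^2 - d^2 = 1/nu]. *)
Lemma mode_state_adjoint nu d s a u v x y :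
  s ^+ 2 = d ^+ 2 + nu^-1 ->
  state_adjoint nu d x y
    (mode s a ((s - d) * u) (- ((s + d) * v))) (mode s a u v).
Proof.
move=> s2; split=> [||t _].
- by apply: derivable_oo_LRcontinuousT => t; apply: ex_derive; exact: is_derive_mode.
- by apply: derivable_oo_LRcontinuousT => t; apply: ex_derive; exact: is_derive_mode.
- have -> : nu^-1 = s ^+ 2 - d ^+ 2 by rewrite s2 addrC addKr.
  by rewrite !derive1E !(@derive_val _ _ _ _ _ _ _ (is_derive_mode _ _ _ _ _)) /mode; split; ring.
Qed.


(* [mode1] spans the solutions with z(0) = 0, and [mode2] those with
   mu(T) + gamma z(T) = 0. *)
Definition mode1_mu s d c : R -> R := mode s 0 (c * (s + d)) (c * (s - d)).
Definition mode1_z s d c : R -> R :=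
  mode s 0 ((s - d) * (c * (s + d))) (- ((s + d) * (c * (s - d)))).

Definition mode2_mu gamma T s d c : R -> R :=
  mode s T (c * (gamma * s - (1 - gamma * d)))
           (c * (gamma * s + (1 - gamma * d))).
Definition mode2_z gamma T s d c : R -> R :=
  mode s T ((s - d) * (c * (gamma * s - (1 - gamma * d))))
           (- ((s + d) * (c * (gamma * s + (1 - gamma * d))))).

(** These four quantities are the numerators and denominators in [ND3_factor] multiplied by
    [2 cosh]; for instance [num1] is [2 cosh(s alpha) (s + d tanh(s alpha))]. *)
Definition num1 s d alpha : R :=
  (s + d) * expR (s * alpha) + (s - d) * expR (- (s * alpha)).
Definition den1 s d alpha : R :=
  (s + d) * expR (s * alpha) - (s - d) * expR (- (s * alpha)).
Definition num2 gamma s d b : R :=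
  (gamma * s + (1 - gamma * d)) * expR (s * b) -
  (gamma * s - (1 - gamma * d)) * expR (- (s * b)).
Definition den2 gamma s d b : R :=
  (gamma * s + (1 - gamma * d)) * expR (s * b) +
  (gamma * s - (1 - gamma * d)) * expR (- (s * b)).

Lemma mode1_mu_end s d c alpha : mode1_mu s d c alpha = c * num1 s d alpha.
Proof. by rewrite /mode1_mu /mode /num1 subr0; ring. Qed.

Lemma mode2_mu_start gamma T s d c alpha :
  mode2_mu gamma T s d c alpha = c * den2 gamma s d (T - alpha).
Proof.
rewrite /mode2_mu /mode /den2.
have -> : s * (alpha - T) = - (s * (T - alpha)) by ring.
by rewrite opprK; ring.
Qed.

Lemma mode2_right_derivative gamma T s d c alpha :
  right_derivative (mode2_mu gamma T s d c) alpha
    (- (s * (c * num2 gamma s d (T - alpha)))).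
Proof.
apply: is_derive_right_derivative; apply: is_derive_eq (is_derive_mode _ _ _ _ _) _.
rewrite /mode /num2.
have -> : s * (alpha - T) = - (s * (T - alpha)) by ring.
by rewrite opprK; ring.
Qed.

Lemma subproblem1_mode nu alpha d s c : s ^+ 2 = d ^+ 2 + nu^-1 ->
  subproblem1 nu alpha d (s * (c * den1 s d alpha))
    (mode1_z s d c) (mode1_mu s d c).
Proof.
move=> s2; split; first exact: mode_state_adjoint.
  by rewrite /mode1_z modexx; ring.
apply: is_derive_left_derivative; apply: is_derive_eq (is_derive_mode _ _ _ _ _) _.
by rewrite /mode /den1 subr0; ring.
Qed.

Lemma subproblem2_mode nu gamma T alpha d s c : s ^+ 2 = d ^+ 2 + nu^-1 ->
  subproblem2 nu gamma T alpha d (c * den2 gamma s d (T - alpha))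
    (mode2_z gamma T s d c) (mode2_mu gamma T s d c).
Proof.
move=> s2; split; first exact: mode_state_adjoint.
  exact: mode2_mu_start.
by rewrite /mode2_z /mode2_mu !modexx; ring.
Qed.

(* If the denominator vanished, every c would solve the problem with datum 0. *)
Lemma den1_neq0 nu alpha d s : 0 < alpha -> 0 < s -> s ^+ 2 = d ^+ 2 + nu^-1 ->
  uniquely_solvable 0 alpha (subproblem1 nu alpha d) -> den1 s d alpha != 0.
Proof.
move=> a0 s0 s2 solv; apply/eqP => den0.
have P c := subproblem1_mode alpha c s2.
have [_ uniq] := solv 0.
have P1 := P 1; have P0 := P 0.
rewrite den0 !mulr0 in P1 P0.
have [|_] := uniq _ _ _ _ P1 P0 0; first by rewrite in_itv/= lexx ltW.
by rewrite /mode1_mu !modexx; lra.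
Qed.

(** As for [den1], but compared at [T]: equality of [mu] gives [2 gamma s = 0], so [gamma = 0], and
    equality of [z] then reads [-2 s = 0]. *)
Lemma den2_neq0 nu gamma T alpha d s :
  alpha < T -> 0 < s -> s ^+ 2 = d ^+ 2 + nu^-1 ->
  uniquely_solvable alpha T (subproblem2 nu gamma T alpha d) ->
  den2 gamma s d (T - alpha) != 0.
Proof.
move=> aT s0 s2 solv; apply/eqP => den0.
have P c := subproblem2_mode gamma T alpha c s2.
have [_ uniq] := solv 0.
have P1 := P 1; have P0 := P 0.
rewrite den0 !mulr0 in P1 P0.
have [|] := uniq _ _ _ _ P1 P0 T; first by rewrite in_itv/= lexx ltW.
rewrite /mode2_z /mode2_mu !modexx => zT muT.
have /eqP : gamma * s = 0 by lra.
rewrite mulf_eq0 (gt_eqF s0) orbF => /eqP g0.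
by move: zT; rewrite g0; lra.
Qed.

(** The signed multiplier of one iteration; [ND3_factor] is its absolute value. *)
Definition amplification nu gamma T alpha theta d : R :=
  let s := Num.sqrt (d ^+ 2 + nu^-1) in
  1 - theta * (1 + num1 s d alpha / den1 s d alpha *
    (num2 gamma s d (T - alpha) / den2 gamma s d (T - alpha))).

Lemma ND3_factorE nu gamma T alpha theta d :
  ND3_factor nu gamma T alpha theta d =
  `|amplification nu gamma T alpha theta d|.
Proof.
rewrite /ND3_factor /amplification; set s := Num.sqrt _.
(* Cancelling the common [w = 2 cosh] stays valid when [q = 0], since the inverse of 0 is 0. *)
have frac (p q p' q' w : R) : w != 0 -> p = p' / w -> q = q' / w -> p / q = p' / q'.
  by move=> w0 -> ->; rewrite invfM invrK mulrACA mulVf// mulr1.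
have w0 (x : R) : expR x + expR (- x) != 0 by rewrite gt_eqF// addr_gt0 ?expR_gt0.
congr `|1 - theta * (1 + _ * _)|.
- apply: (frac _ _ _ _ _ (w0 (s * alpha))); rewrite /tanh /num1 /den1;
    by field; apply: w0.
- apply: (frac _ _ _ _ _ (w0 (s * (T - alpha)))); rewrite /tanh /num2 /den2;
    by field; apply: w0.
Qed.

Lemma ND3_stepP nu gamma T alpha theta d f f' :
  0 < nu -> 0 < alpha < T ->
  uniquely_solvable 0 alpha (subproblem1 nu alpha d) ->
  uniquely_solvable alpha T (subproblem2 nu gamma T alpha d) ->
  ND3_step nu gamma T alpha theta d f f' <->
  f' = amplification nu gamma T alpha theta d * f.
Proof.
move=> nu0 /andP[a0 aT] solv1 solv2; rewrite /amplification.
set s := Num.sqrt _.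
have e0 : 0 < d ^+ 2 + nu^-1 by rewrite ltr_wpDl ?sqr_ge0 ?invr_gt0.
have s0 : 0 < s by rewrite sqrtr_gt0.
have s2 : s ^+ 2 = d ^+ 2 + nu^-1 by rewrite sqr_sqrtr// ltW.
have D1 := den1_neq0 a0 s0 s2 solv1.
have D2 := den2_neq0 aT s0 s2 solv2.
(* [c1] is fixed by the Neumann datum, [s * c1 * den1 = f], and [c2] by matching [mu] at [alpha],
   [c2 * den2 = c1 * num1]. *)
pose c1 := f / (s * den1 s d alpha).
pose c2 := c1 * num1 s d alpha / den2 gamma s d (T - alpha).
have P1 : subproblem1 nu alpha d f (mode1_z s d c1) (mode1_mu s d c1).
  have := subproblem1_mode alpha c1 s2; congr (subproblem1 _ _ _ _ _ _).
  by rewrite /c1; field; rewrite D1 gt_eqF.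
have P2 : subproblem2 nu gamma T alpha d (mode1_mu s d c1 alpha)
    (mode2_z gamma T s d c2) (mode2_mu gamma T s d c2).
  have := subproblem2_mode gamma T alpha c2 s2.
  congr (subproblem2 _ _ _ _ _ _ _ _).
  by rewrite mode1_mu_end /c2 divfK.
have Q := @mode2_right_derivative gamma T s d c2 alpha.
set l := - _ in Q.
have stepE : (1 - theta) * f + theta * l =
    (1 - theta * (1 + num1 s d alpha / den1 s d alpha *
    (num2 gamma s d (T - alpha) / den2 gamma s d (T - alpha)))) * f.
  by rewrite /l /c2 /c1; field; rewrite D1 D2 gt_eqF.
split=> [[z1 [mu1 [z2 [mu2 [l' [Q1 Q2 Q' ->]]]]]]|->].
(* An arbitrary step is compared with the explicit one: uniqueness on the first subdomain identifies
   the transmitted Dirichlet datum, then uniqueness on the second identifies [mu2] and its right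
   derivative. *)
- have muE : mu1 alpha = mode1_mu s d c1 alpha.
    apply: ((solv1 f).2 _ _ _ _ Q1 P1 alpha _).2.
    by rewrite in_itv/= lexx ltW.
  rewrite muE in Q2; rewrite -stepE; congr (_ + _ * _).
  apply: (right_derivative_unique aT _ Q' Q) => t tI.
  exact: ((solv2 _).2 _ _ _ _ Q2 P2 t tI).2.
- exists (mode1_z s d c1), (mode1_mu s d c1).
  exists (mode2_z gamma T s d c2), (mode2_mu gamma T s d c2), l.
  by split.
Qed.

End modes.

(** If [|r| >= 1], every power has absolute value at least 1, so no tail comes within distance 1 of
    0. *)
Lemma cvg_expr_lt1 (R : realType) (r : R) :
  r ^+ k @[k --> \oo] --> 0 <-> `|r| < 1.
Proof.
split=> [r0|/cvg_expr//]; rewrite ltNge; apply/negP => r1.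
have /cvgrPdist_lt/(_ 1 ltr01)[N _ /(_ N (leqnn _))] := r0.
by rewrite /= sub0r normrN normrX ltNge exprn_ege1.
Qed.

Theorem theorem11 (R : realType) (n : nat) (hn : (0 < n)%N)
    (A : 'M[R]_n) (symA : A^T = A)
    (d : 'I_n -> R) (eigA : char_poly A = \prod_(i < n) ('X - (d i)%:P))
    (nu gamma T alpha theta : R)
    (hnu : 0 < nu) (hgamma : 0 <= gamma) (hT : 0 < T)
    (halpha : 0 < alpha < T) (htheta : 0 < theta < 1)
    (solv1 : forall i : 'I_n,
       uniquely_solvable 0 alpha (subproblem1 nu alpha (d i)))
    (solv2 : forall i : 'I_n,
       uniquely_solvable alpha T (subproblem2 nu gamma T alpha (d i))) :
  ND3_converges nu gamma T alpha theta d <->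
  rho_ND3 nu gamma T alpha theta d < 1.
Proof.
pose r i := amplification nu gamma T alpha theta (d i).
have stepP i f f' : ND3_step nu gamma T alpha theta (d i) f f' <-> f' = r i * f.
  exact: ND3_stepP.
split=> [cv|/bigmax_ltP[_ rho] f0 f orb i].
(* The maximum is below 1 iff its default value 0 and all factors are. *)
- apply/bigmax_ltP; split=> // i _; rewrite ND3_factorE -/(r i).
  apply/cvg_expr_lt1.
  (* The constant guess 1 excites every eigenvalue at once, and its orbit consists of the powers of
     the multipliers. *)
  apply: (cv (fun=> 1) (fun k i => r i ^+ k)) => j; split=> // k.
  by apply/stepP; rewrite exprS.
- have [_ step] := orb i.
  have -> : f ^~ i = (fun k => r i ^+ k * f 0 i).
    apply/funext; elim=> [|k IH]; first by rewrite mul1r.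
    by rewrite ((stepP _ _ _).1 (step k)) IH exprS mulrA.
  rewrite -[X in _ --> X](mul0r (f 0 i)); apply: cvgMl.
  by apply/cvg_expr_lt1; rewrite -ND3_factorE rho.
Qed.
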